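(* Consider the planar ODE $z_1'=-(z_2-\beta)$, $z_2'=z_1(1-e^{-\alpha z_2})$ on $\mathbb{R}\times[0,\infty)$, with parameters $\alpha,\beta>0$. There exists a scaling of this ODE (of the variables $z_1,z_2$ and of time $t$, involving a parameter $\varepsilon>0$) converting it to the standard fast-slow form $\varepsilon\dot x=f(x,y,\varepsilon)$, $\dot y=g(x,y,\varepsilon)$, with the invariant manifold $\mathcal{M}=\{z_2=0\}$ becoming the subset $\{x=0\}$ of the critical manifold. Furthermore, balancing the function $\mathcal{F}_\rho$ yields the correct exit point: for every $b>0$ and the slow-subsystem trajectory in $\{x=0\}$ entering at $(x,y)=(0,-b)$, the exit point obtained by balancing $\mathcal{F}_\rho$ is $(x,y)=(0,b)$.
   Context: Fast-slow notation: for a system $\varepsilon\dot x=f(x,y,\varepsilon)$, $\dot y=g(x,y,\varepsilon)$ with $f,g$ smooth, $0<\varepsilon\ll1$, and the dot denoting the derivative with respect to slow time $s$, the critical manifold is $\mathcal{C}_0=\{f(x,y,0)=0\}$ and the slow subsystem is $0=f(x,y,0)$, $\dot y=g(x,y,0)$. Here $x$ is the (scaled) $z_2$-variable and $y$ the (scaled) $z_1$-variable, both one-dimensional. For a slow-subsystem trajectory $\gamma(s)$ in $\{x=0\}\subset\mathcal{C}_0$ with $\gamma(s_0)=(0,-b)$, put $\rho(s)=\mathrm{D}_xf(\gamma(s),0)\in\mathbb{R}$ and $\mathcal{F}_\rho(t)=\int_{s_0}^t\rho(s)\,\mathrm{d}s$. Balancing $\mathcal{F}_\rho$ means taking as exit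 time the first nontrivial zero $T>s_0$ of $\mathcal{F}_\rho$ and as exit point $\gamma(T)$. The correct exit relation is the symmetric one: by the symmetry $(z_1,z_2,t)\mapsto(-z_1,z_2,-t)$ of the ODE, a particle entering a small neighbourhood $\{0\le z_2\le\chi\}$ of $\mathcal{M}$ at first coordinate $-b$ first exits it at first coordinate $b$. *)

(* Defs.v *)
From Stdlib Require Import Reals.
From Coquelicot Require Import Coquelicot.
Open Scope R_scope.

(** Smooth functions of three real variables: [Cn k h] says that [h] has all
    partial derivatives of order at most [k], and that they are jointly
    continuous on R^3. *)
Fixpoint Cn (k : nat) (h : R -> R -> R -> R) : Prop :=
  (forall p : R * R * R,
      continuous (fun q : R * R * R => h (fst (fst q)) (snd (fst q)) (snd q)) p) /\
  match k with
  | O => True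
  | S k' =>
      exists h1 h2 h3 : R -> R -> R -> R,
        (forall x y e : R,
            is_derive (fun u => h u y e) x (h1 x y e) /\
            is_derive (fun u => h x u e) y (h2 x y e) /\
            is_derive (fun u => h x y u) e (h3 x y e)) /\
        Cn k' h1 /\ Cn k' h2 /\ Cn k' h3
  end.

Definition smooth (h : R -> R -> R -> R) : Prop := forall k : nat, Cn k h.

(** Open intervals of R, bounded or unbounded (the empty set is allowed). *)
Definition is_open_interval (I : R -> Prop) : Prop :=
  open I /\ forall a b c : R, I a -> I b -> a <= c <= b -> I c.

(** The planar ODE; states are pairs [(z1, z2)] with [0 <= z2]. *)
Definition ode_solution (alpha beta : R) (I : R -> Prop) (z : R -> R * R) : Prop :=
  forall t : R, I t ->
    0 <= snd (z t) /\
    is_derive (fun u => fst (z u)) t (- (snd (z t) - beta)) /\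
    is_derive (fun u => snd (z u)) t (fst (z t) * (1 - exp (- alpha * snd (z t)))).

Definition manifold_M (z : R * R) : Prop := snd z = 0.

Definition nbhd_M (chi : R) (z : R * R) : Prop := 0 <= snd z <= chi.

Definition first_exit_time (N : R * R -> Prop) (z : R -> R * R) (t0 T : R) : Prop :=
  t0 < T /\
  (forall t : R, t0 <= t <= T -> N (z t)) /\
  (forall delta : R, 0 < delta -> exists t : R, T < t < T + delta /\ ~ N (z t)).

(** Fast-slow systems; states are pairs [(x, y)], with [x] fast and [y] slow,
    and time is the slow time. *)
Definition fast_slow_solution (f g : R -> R -> R -> R) (eps : R)
    (I : R -> Prop) (gamma : R -> R * R) : Prop :=
  forall s : R, I s ->
    ex_derive (fun u => fst (gamma u)) s /\
    ex_derive (fun u => snd (gamma u)) s /\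
    eps * Derive (fun u => fst (gamma u)) s = f (fst (gamma s)) (snd (gamma s)) eps /\
    Derive (fun u => snd (gamma u)) s = g (fst (gamma s)) (snd (gamma s)) eps.

Definition critical_manifold (f : R -> R -> R -> R) (p : R * R) : Prop :=
  f (fst p) (snd p) 0 = 0.

Definition slow_trajectory (f g : R -> R -> R -> R)
    (I : R -> Prop) (gamma : R -> R * R) : Prop :=
  forall s : R, I s ->
    critical_manifold f (gamma s) /\
    is_derive (fun u => snd (gamma u)) s (g (fst (gamma s)) (snd (gamma s)) 0).

(** A scaling [z1 = c1 * y], [z2 = c2 * x], [t = ct * s] whose factors may
    depend on [eps]; note the exchange of coordinates. *)
Record scaling := Scaling {
  c1 : R -> R;
  c2 : R -> R;
  ct : R -> R;
  scaling_pos : forall eps : R, 0 < eps -> 0 < c1 eps /\ 0 < c2 eps /\ 0 < ct eps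
}.

Definition unscale (S : scaling) (eps : R) (p : R * R) : R * R :=
  (c1 S eps * snd p, c2 S eps * fst p).

(** The scaling exchanges the solutions of the ODE on the half-plane
    [0 <= z2] with those of the fast-slow system on [0 <= x]. *)
Definition converts (alpha beta : R) (S : scaling) (f g : R -> R -> R -> R) : Prop :=
  forall (eps : R) (I : R -> Prop) (gamma : R -> R * R),
    0 < eps -> is_open_interval I ->
    ((forall s : R, I s -> 0 <= fst (gamma s)) /\ fast_slow_solution f g eps I gamma
     <->
     ode_solution alpha beta (fun t => I (t / ct S eps))
                  (fun t => unscale S eps (gamma (t / ct S eps)))).

Definition rho (f : R -> R -> R -> R) (gamma : R -> R * R) (s : R) : R :=
  Derive (fun x => f x (snd (gamma s)) 0) (fst (gamma s)).

Definition F_rho (f : R -> R -> R -> R) (gamma : R -> R * R) (s0 t : R) : R :=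
  RInt (rho f gamma) s0 t.

Definition balanced_exit_time (f : R -> R -> R -> R) (gamma : R -> R * R)
    (s0 T : R) : Prop :=
  s0 < T /\ F_rho f gamma s0 T = 0 /\
  forall t : R, s0 < t < T -> F_rho f gamma s0 t <> 0.

Definition slow_trajectory_entering (f g : R -> R -> R -> R)
    (I : R -> Prop) (gamma : R -> R * R) (s0 b : R) : Prop :=
  is_open_interval I /\ (forall s : R, s0 <= s -> I s) /\
  slow_trajectory f g I gamma /\
  (forall s : R, I s -> fst (gamma s) = 0) /\
  gamma s0 = (0, - b).

(* Main.v *)
Require Import Defs.
From Stdlib Require Import Reals Lra Classical.
From Coquelicot Require Import Coquelicot.
Open Scope R_scope.

(** The scaling is [z1 = y / sqrt eps], [z2 = x], [t = s / sqrt eps], which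
    gives [f = y (1 - exp (- alpha x))] and [g = beta - x].

    On [{x = 0}] the slow flow is [y' = beta], so a trajectory entering at
    [y = - b] is [y(s) = - b + beta (s - s0)].  Moreover
    [rho = alpha y = (alpha / beta) y y'], whence
    [F_rho(t) = alpha / (2 beta) (y(t)^2 - b^2)]: the first zero after [s0] is
    the time at which [y = b] ([F_rho_slow_flow]).

    For the true exit point, let a solution start at [(- B, chi)] with
    [B > 0] and [0 < chi < beta].  While [z2 <= chi], the coordinate [z1]
    increases at rate at least [beta - chi] ([layer_drift]) and [z2] stays
    positive ([layer_pos]), so the energy [z1^2 / 2 + G(z2)] is defined and
    conserved, where [G' = (z2 - beta) / (1 - exp (- alpha z2))] and
    [G(chi) = 0] ([energy_conserved]).  As [G >= 0] on [(0, chi]], this gives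
    [z1 <= B], so [z2 <= chi] cannot persist.  At the supremum [T] of the
    times up to which it does, [z2 = chi], so [z1^2 = B^2], and [z1 > - B]
    because [z1] has increased; hence [z1(T) = B] ([layer_exit]).  Energy
    conservation thus replaces the time-reversal symmetry, which would
    require a uniqueness theorem for the ODE. *)

(** * Calculus preliminaries *)

Lemma mean_value (h dh : R -> R) (a b : R) :
  a <= b -> (forall t, a <= t <= b -> is_derive h t (dh t)) ->
  exists c, a <= c <= b /\ h b - h a = dh c * (b - a).
Proof.
  intros Hab Hd.
  destruct (MVT_gen h a b dh) as [c [Hc Heq]].
  - intros x Hx. rewrite Rmin_left, Rmax_right in Hx by lra. apply Hd; lra.
  - intros x Hx. rewrite Rmin_left, Rmax_right in Hx by lra.
    apply continuity_pt_filterlim, (ex_derive_continuous h x).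
    exists (dh x); apply Hd; lra.
  - rewrite Rmin_left, Rmax_right in Hc by lra. now exists c.
Qed.

Lemma is_derive_val (h : R -> R) (x l l' : R) :
  is_derive h x l -> l = l' -> is_derive h x l'.
Proof. now intros H <-. Qed.

Lemma one_minus_exp_pos (a u : R) : 0 < a -> 0 < u -> 0 < 1 - exp (- a * u).
Proof.
  intros Ha Hu. rewrite <- exp_0.
  assert (exp (- a * u) < exp 0) by (apply exp_increasing; nra). lra.
Qed.

Lemma one_minus_exp_bounds (a u : R) :
  0 < a -> 0 <= u -> 0 <= 1 - exp (- a * u) <= a * u.
Proof.
  intros Ha Hu. split.
  - destruct Hu as [Hu | <-].
    + left; now apply one_minus_exp_pos.
    + rewrite Rmult_0_r, exp_0; lra.
  - pose proof (exp_ineq1_le (- a * u)); lra.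
Qed.

(** * Smoothness of the fast-slow vector field *)

Lemma continuous_affine_exp (a p q r u v : R) (w : R * R * R) :
  continuous (fun w : R * R * R =>
    p + q * fst (fst w) + r * snd (fst w)
    + (u + v * snd (fst w)) * exp (- a * fst (fst w))) w.
Proof.
  assert (Hx : continuous (fun q : R * R * R => fst (fst q)) w)
    by (apply continuous_comp; apply continuous_fst).
  assert (Hy : continuous (fun q : R * R * R => snd (fst q)) w)
    by (apply continuous_comp; [apply continuous_fst | apply continuous_snd]).
  assert (Hc : forall c : R, continuous (fun _ : R * R * R => c) w)
    by (intros c; apply continuous_const).
  assert (Hm : forall h1 h2 : R * R * R -> R,
            continuous h1 w -> continuous h2 w ->
            continuous (fun q : R * R * R => h1 q * h2 q) w)
    by (intros h1 h2 H1 H2; exact (continuous_mult h1 h2 w H1 H2)).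
  assert (Hp : forall h1 h2 : R * R * R -> R,
            continuous h1 w -> continuous h2 w ->
            continuous (fun q : R * R * R => h1 q + h2 q) w)
    by (intros h1 h2 H1 H2; exact (continuous_plus h1 h2 w H1 H2)).
  assert (He : continuous (fun q : R * R * R => exp (- a * fst (fst q))) w).
  { apply (continuous_comp (fun q : R * R * R => - a * fst (fst q)) exp).
    - now apply Hm.
    - apply (ex_derive_continuous (V := R_NormedModule)). auto_derive; auto. }
  repeat first [assumption | apply Hc | apply Hp | apply Hm].
Qed.

(** A family of functions that contains both components of the vector field
    and is closed under partial derivatives. *)
Lemma Cn_affine_exp (a : R) (k : nat) :
  forall p q r u v : R,
    Cn k (fun x y _ => p + q * x + r * y + (u + v * y) * exp (- a * x)).
Proof.
  induction k as [| k IH]; intros p q r u v;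
    (split; [intros w; apply continuous_affine_exp |]); [exact I |].
  exists (fun x y _ => q + 0 * x + 0 * y + (- a * u + - a * v * y) * exp (- a * x)),
    (fun x y _ => r + 0 * x + 0 * y + (v + 0 * y) * exp (- a * x)),
    (fun x y _ => 0 + 0 * x + 0 * y + (0 + 0 * y) * exp (- a * x)).
  split; [| auto].
  intros x y e; split; [| split]; cbv beta; auto_derive; auto; ring.
Qed.

Lemma Cn_ext (k : nat) :
  forall h h' : R -> R -> R -> R,
    (forall x y e, h x y e = h' x y e) -> Cn k h -> Cn k h'.
Proof.
  induction k as [| k IH]; intros h h' E [Hc Hd]; split; auto.
  1, 2: intros p; eapply continuous_ext; [| apply (Hc p)];
    intros; simpl; apply E.
  destruct Hd as (h1 & h2 & h3 & Hd & H123).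
  exists h1, h2, h3; split; [| exact H123].
  intros x y e; destruct (Hd x y e) as (D1 & D2 & D3).
  split; [| split].
  - eapply is_derive_ext; [| exact D1]; intros; apply E.
  - eapply is_derive_ext; [| exact D2]; intros; apply E.
  - eapply is_derive_ext; [| exact D3]; intros; apply E.
Qed.

(** * The scaling and the fast-slow system *)

(** The right-hand side of the fast equation [eps x' = y (1 - exp (- alpha x))],
    which does not depend on [eps]. *)
Definition fast_field (alpha : R) (x y eps : R) : R := y * (1 - exp (- alpha * x)).

(** The right-hand side of the slow equation [y' = beta - x]. *)
Definition slow_field (beta : R) (x y eps : R) : R := beta - x.

Lemma smooth_fast_field (alpha : R) : smooth (fast_field alpha).
Proof.
  intros k. apply (Cn_ext k _ _) with (2 := Cn_affine_exp alpha k 0 0 1 0 (-1)).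
  intros; unfold fast_field; ring.
Qed.

Lemma smooth_slow_field (beta : R) : smooth (slow_field beta).
Proof.
  intros k. apply (Cn_ext k _ _) with (2 := Cn_affine_exp 0 k beta (-1) 0 0 0).
  intros; unfold slow_field; ring.
Qed.

Lemma sqrt_scaling_pos (eps : R) :
  0 < eps -> 0 < / sqrt eps /\ 0 < 1 /\ 0 < / sqrt eps.
Proof.
  intros He. pose proof (Rinv_0_lt_compat _ (sqrt_lt_R0 _ He)). lra.
Qed.

(** Time and [z1] are both stretched by [1 / sqrt eps]; [z2] is unchanged. *)
Definition sqrt_scaling : scaling :=
  Scaling (fun eps => / sqrt eps) (fun _ => 1) (fun eps => / sqrt eps)
    sqrt_scaling_pos.

Lemma is_derive_scale_time (h : R -> R) (a c t l : R) :
  c <> 0 -> is_derive h (t / c) l ->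
  is_derive (fun u => a * h (u / c)) t (a * l / c).
Proof.
  intros Hc H.
  apply is_derive_val with (a * (/ c * l)); [| field; exact Hc].
  apply is_derive_scal.
  apply (is_derive_comp h (fun u => u / c)); [exact H |].
  auto_derive; auto. now field.
Qed.

Lemma is_derive_unscale_time (h : R -> R) (a c s l : R) :
  a <> 0 -> c <> 0 ->
  is_derive (fun u => a * h (u / c)) (c * s) l -> is_derive h s (l * c / a).
Proof.
  intros Ha Hc H.
  apply is_derive_ext with (fun v => / a * (fun u => a * h (u / c)) (v / / c)).
  { assert (Hv : forall v : R, / a * (a * h (v / / c / c)) = h v).
    { intros v. replace (v / / c / c) with v by (now field). now field. }
    exact Hv. }
  apply is_derive_val with (/ a * l / / c); [| field; auto].
  apply (is_derive_scale_time (fun u => a * h (u / c))).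
  - now apply Rinv_neq_0_compat.
  - replace (s / / c) with (c * s) by (field; auto). exact H.
Qed.

Lemma sqrt_scaling_converts (alpha beta : R) :
  converts alpha beta sqrt_scaling (fast_field alpha) (slow_field beta).
Proof.
  intros eps I gamma He _; unfold unscale; simpl.
  pose proof (sqrt_lt_R0 _ He) as Hs.
  pose proof (sqrt_sqrt eps (Rlt_le _ _ He)) as Hss.
  set (c := / sqrt eps).
  assert (Hc : c <> 0) by (apply Rinv_neq_0_compat; lra).
  assert (Hcc : eps * c * c = 1).
  { unfold c. rewrite <- Hss at 1. field. lra. }
  split.
  - intros [Hpos Hsol] t It.
    destruct (Hsol _ It) as (D1 & D2 & E1 & E2).
    unfold fast_field, slow_field in E1, E2.
    specialize (Hpos _ It).
    set (x := fst (gamma (t / c))) in *; set (y := snd (gamma (t / c))) in *.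
    assert (D2' : is_derive (fun u : R => snd (gamma u)) (t / c) (beta - x))
      by (rewrite <- E2; exact (Derive_correct _ _ D2)).
    assert (D1' : is_derive (fun u : R => fst (gamma u)) (t / c)
                    (c * c * y * (1 - exp (- alpha * x)))).
    { eapply is_derive_val; [exact (Derive_correct _ _ D1) |].
      apply Rmult_eq_reg_l with eps; [| lra].
      eapply eq_trans; [exact E1 |].
      transitivity (eps * c * c * (y * (1 - exp (- alpha * x)))); [| ring].
      rewrite Hcc; ring. }
    simpl; fold x y. split; [lra | split].
    + eapply is_derive_val.
      * apply (is_derive_scale_time (fun u => snd (gamma u)));
          [exact Hc | exact D2'].
      * field. exact Hc.
    + eapply is_derive_val.
      * apply (is_derive_scale_time (fun u => fst (gamma u)));
          [exact Hc | exact D1'].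
      * rewrite (Rmult_1_l x). field. exact Hc.
  - intros Hsol.
    assert (Hts : forall s, c * s / c = s) by (intros s; field; exact Hc).
    assert (H : forall s, I s -> 0 <= fst (gamma s) /\
              is_derive (fun u => snd (gamma u)) s (beta - fst (gamma s)) /\
              is_derive (fun u => fst (gamma u)) s
                (c * c * snd (gamma s) * (1 - exp (- alpha * fst (gamma s))))).
    { intros s Is.
      destruct (Hsol (c * s)) as (P & D1 & D2).
      - fold c. now rewrite Hts.
      - fold c in P, D1, D2. simpl in P, D1, D2.
        rewrite Hts, Rmult_1_l in P.
        apply (is_derive_unscale_time (fun u => snd (gamma u))) in D1; auto.
        apply (is_derive_unscale_time (fun u => fst (gamma u))) in D2; auto.
        rewrite Hts, Rmult_1_l in D1, D2.
        split; [exact P | split].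
        + eapply is_derive_val; [exact D1 | field; exact Hc].
        + eapply is_derive_val; [exact D2 | field]. }
    split; [intros s Is; now apply H |].
    intros s Is; destruct (H s Is) as (P & D1 & D2).
    split; [eexists; exact D2 | split; [eexists; exact D1 |]].
    apply is_derive_unique in D1; apply is_derive_unique in D2.
    unfold fast_field, slow_field; split; [| exact D1].
    eapply eq_trans; [exact (f_equal (Rmult eps) D2) |].
    transitivity (eps * c * c *
      (snd (gamma s) * (1 - exp (- alpha * fst (gamma s))))); [ring |].
    rewrite Hcc; ring.
Qed.

(** * Balancing along the slow flow *)

Lemma slow_flow (alpha beta : R) (I : R -> Prop) (gamma : R -> R * R) (s0 b s : R) :
  slow_trajectory_entering (fast_field alpha) (slow_field beta) I gamma s0 b ->
  s0 <= s -> gamma s = (0, - b + beta * (s - s0)).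
Proof.
  intros (_ & HI & Htr & Hx & H0) Hs.
  destruct (mean_value (fun u => snd (gamma u))
              (fun u => slow_field beta (fst (gamma u)) (snd (gamma u)) 0) s0 s Hs)
    as [c [Hc E]].
  - intros t Ht. apply Htr, HI; lra.
  - cbv beta in E. rewrite H0, (Hx c) in E by (apply HI; lra).
    unfold slow_field in E; simpl in E.
    rewrite (surjective_pairing (gamma s)), (Hx s) by (apply HI; lra).
    f_equal; lra.
Qed.

Lemma rho_fast_field (alpha : R) (gamma : R -> R * R) (s y : R) :
  gamma s = (0, y) -> rho (fast_field alpha) gamma s = alpha * y.
Proof.
  intros E. unfold rho. rewrite E; simpl. apply is_derive_unique.
  unfold fast_field. auto_derive; auto.
  rewrite Rmult_0_r, exp_0. ring.
Qed.

Lemma F_rho_slow_flow (alpha beta : R) (I : R -> Prop) (gamma : R -> R * R)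
    (s0 b t : R) :
  slow_trajectory_entering (fast_field alpha) (slow_field beta) I gamma s0 b ->
  s0 <= t ->
  F_rho (fast_field alpha) gamma s0 t =
    alpha / 2 * (t - s0) * (beta * (t - s0) - 2 * b).
Proof.
  intros Hg Ht. unfold F_rho.
  rewrite RInt_ext with (g := fun s => alpha * (- b + beta * (s - s0))).
  2: { intros s Hs. rewrite Rmin_left in Hs by lra.
       apply rho_fast_field. apply (slow_flow _ _ _ _ _ _ _ Hg); lra. }
  set (P := fun s => alpha / 2 * (s - s0) * (beta * (s - s0) - 2 * b)).
  apply is_RInt_unique.
  replace (alpha / 2 * (t - s0) * (beta * (t - s0) - 2 * b))
    with (minus (P t) (P s0)).
  2: { unfold P, minus, plus, opp; simpl. field. }
  apply (is_RInt_derive P).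
  - intros s _. unfold P. auto_derive; auto. field.
  - intros s _. apply (ex_derive_continuous (V := R_NormedModule)).
    auto_derive; auto.
Qed.

Lemma balanced_exit_slow_flow (alpha beta : R) (I : R -> Prop)
    (gamma : R -> R * R) (s0 b : R) :
  0 < alpha -> 0 < beta -> 0 < b ->
  slow_trajectory_entering (fast_field alpha) (slow_field beta) I gamma s0 b ->
  exists T, balanced_exit_time (fast_field alpha) gamma s0 T /\ gamma T = (0, b).
Proof.
  intros Ha Hbeta Hb Hg.
  assert (HT : 0 < 2 * b / beta) by (apply Rdiv_lt_0_compat; lra).
  assert (HTb : beta * (2 * b / beta) = 2 * b) by (field; lra).
  exists (s0 + 2 * b / beta); split; [split; [lra | split] |].
  - rewrite (F_rho_slow_flow _ _ _ _ _ _ _ Hg) by lra.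
    replace (s0 + 2 * b / beta - s0) with (2 * b / beta) by ring.
    rewrite HTb; ring.
  - intros t Ht. rewrite (F_rho_slow_flow _ _ _ _ _ _ _ Hg) by lra.
    apply Rmult_integral_contrapositive; split; [| nra].
    apply Rmult_integral_contrapositive; split; lra.
  - rewrite (slow_flow _ _ _ _ _ _ _ Hg) by lra.
    f_equal. replace (s0 + 2 * b / beta - s0) with (2 * b / beta) by ring. lra.
Qed.

Lemma slow_trajectory_exists (alpha beta b s0 : R) :
  slow_trajectory_entering (fast_field alpha) (slow_field beta)
    (fun _ => True) (fun s => (0, - b + beta * (s - s0))) s0 b.
Proof.
  split; [split; [apply open_true | auto] |].
  split; [auto |].
  split; [| split; [auto | f_equal; ring]].
  intros s _; split.
  - unfold critical_manifold, fast_field; simpl.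
    rewrite Rmult_0_r, exp_0; ring.
  - unfold slow_field; simpl. auto_derive; auto; ring.
Qed.

(** * The conserved energy *)

(** The potential [G] in the conserved energy [z1^2 / 2 + G(z2)], normalised
    by [G(chi) = 0]. *)
Definition potential (alpha beta chi u : R) : R :=
  RInt (fun v => (v - beta) / (1 - exp (- alpha * v))) chi u.

Lemma is_derive_potential (alpha beta chi u : R) :
  0 < alpha -> 0 < chi -> 0 < u ->
  is_derive (potential alpha beta chi) u ((u - beta) / (1 - exp (- alpha * u))).
Proof.
  intros Ha Hchi Hu. set (k := fun v => (v - beta) / (1 - exp (- alpha * v))).
  assert (Hk : forall v, 0 < v -> continuous k v).
  { intros v Hv. apply (ex_derive_continuous k). unfold k. auto_derive.
    pose proof (one_minus_exp_pos alpha v Ha Hv). lra. }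
  apply (is_derive_RInt k (potential alpha beta chi) chi u); [| now apply Hk].
  exists (mkposreal u Hu). intros w Hw.
  apply (RInt_correct k), (ex_RInt_continuous k).
  intros v Hv. apply Hk.
  assert (0 < w).
  { change (Rabs (w - u) < u) in Hw. apply Rabs_def2 in Hw. lra. }
  assert (0 < Rmin chi w) by (now apply Rmin_glb_lt). lra.
Qed.

Lemma potential_at_chi (alpha beta chi : R) : potential alpha beta chi chi = 0.
Proof. apply (RInt_point (V := R_CompleteNormedModule)). Qed.

Lemma potential_nonneg (alpha beta chi u : R) :
  0 < alpha -> 0 < u <= chi -> chi <= beta -> 0 <= potential alpha beta chi u.
Proof.
  intros Ha Hu Hchi.
  destruct (mean_value (potential alpha beta chi)
    (fun v => (v - beta) / (1 - exp (- alpha * v))) u chi) as [c [Hc E]]; [lra | |].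
  - intros t Ht; apply is_derive_potential; lra.
  - rewrite potential_at_chi in E.
    pose proof (Rinv_0_lt_compat _ (one_minus_exp_pos alpha c Ha ltac:(lra))).
    assert (0 <= (beta - c) / (1 - exp (- alpha * c)) * (chi - u)).
    { apply Rmult_le_pos; [| lra]. apply Rmult_le_pos; lra. }
    unfold Rdiv in *. nra.
Qed.

Lemma energy_conserved (alpha beta chi t0 tau : R) (I : R -> Prop) (z : R -> R * R) :
  0 < alpha -> 0 < chi -> (forall t, t0 <= t -> I t) ->
  ode_solution alpha beta I z -> t0 <= tau ->
  (forall t, t0 <= t <= tau -> 0 < snd (z t)) ->
  fst (z tau) ^ 2 / 2 + potential alpha beta chi (snd (z tau)) =
  fst (z t0) ^ 2 / 2 + potential alpha beta chi (snd (z t0)).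
Proof.
  intros Ha Hchi HI Hz Htau Hpos.
  destruct (mean_value
    (fun t => fst (z t) ^ 2 / 2 + potential alpha beta chi (snd (z t)))
    (fun _ => 0) t0 tau Htau) as [c [_ E]]; [| cbv beta in E; lra].
  intros t Ht.
  destruct (Hz t) as (_ & D1 & D2); [apply HI; lra |].
  specialize (Hpos t Ht).
  pose proof (one_minus_exp_pos alpha _ Ha Hpos) as He.
  eapply is_derive_val.
  - apply (is_derive_plus (V := R_NormedModule)
             (fun t => fst (z t) ^ 2 / 2)
             (fun t => potential alpha beta chi (snd (z t)))).
    + apply (is_derive_comp (fun v => v ^ 2 / 2) (fun t => fst (z t)));
        [| exact D1].
      apply is_derive_val with (fst (z t)); [| reflexivity].
      auto_derive; auto; field.
    + apply (is_derive_comp (potential alpha beta chi) (fun t => snd (z t)));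
        [| exact D2].
      now apply is_derive_potential.
  - unfold plus, scal; simpl; unfold mult; simpl. field. lra.
Qed.

(** * Entry and exit of the layer near the invariant manifold *)

Lemma layer_drift (alpha beta chi t0 tau : R) (I : R -> Prop) (z : R -> R * R) :
  (forall t, t0 <= t -> I t) ->
  ode_solution alpha beta I z -> t0 <= tau ->
  (forall t, t0 <= t <= tau -> snd (z t) <= chi) ->
  fst (z t0) + (beta - chi) * (tau - t0) <= fst (z tau).
Proof.
  intros HI Hz Htau Hl.
  destruct (mean_value (fun t => fst (z t)) (fun t => - (snd (z t) - beta))
    t0 tau Htau) as [c [Hc E]].
  - intros t Ht. apply Hz, HI; lra.
  - cbv beta in E. specialize (Hl c Hc). nra.
Qed.

(** In the layer [z1 >= - B], so [z2' >= - alpha B z2] and [z2] decays at most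
    exponentially. *)
Lemma layer_pos (alpha beta chi B t0 tau : R) (I : R -> Prop) (z : R -> R * R) :
  0 < alpha -> 0 < B -> 0 < chi < beta -> (forall t, t0 <= t -> I t) ->
  ode_solution alpha beta I z -> z t0 = (- B, chi) -> t0 <= tau ->
  (forall t, t0 <= t <= tau -> snd (z t) <= chi) ->
  0 < snd (z tau).
Proof.
  intros Ha HB Hchi HI Hz H0 Htau Hl.
  set (m := alpha * B).
  destruct (mean_value (fun t => snd (z t) * exp (m * (t - t0)))
    (fun t => (fst (z t) * (1 - exp (- alpha * snd (z t))) + m * snd (z t))
              * exp (m * (t - t0))) t0 tau Htau) as [c [Hc E]].
  - intros t Ht. destruct (Hz t) as (_ & _ & D2); [apply HI; lra |].
    eapply is_derive_val.
    + apply (is_derive_mult (fun t => snd (z t)) (fun t => exp (m * (t - t0))));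
        [exact D2 | | intros; apply Rmult_comm].
      apply is_derive_val with (m * exp (m * (t - t0))); [| reflexivity].
      auto_derive; auto. unfold Rminus; ring.
    + unfold plus, mult; simpl; ring.
  - assert (Hd : - B <= fst (z c)).
    { pose proof (layer_drift alpha beta chi t0 c I z HI Hz (proj1 Hc)) as H.
      rewrite H0 in H; simpl in H.
      assert (0 <= (beta - chi) * (c - t0)) by (apply Rmult_le_pos; lra).
      enough (- B + (beta - chi) * (c - t0) <= fst (z c)) by lra.
      apply H; intros; apply Hl; lra. }
    destruct (Hz c) as (P & _ & _); [apply HI; lra |].
    pose proof (one_minus_exp_bounds alpha _ Ha P) as Hb.
    pose proof (exp_pos (m * (c - t0))) as Hec.
    pose proof (exp_pos (m * (tau - t0))) as Het.
    assert (Hk : 0 <= fst (z c) * (1 - exp (- alpha * snd (z c)))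
                      + m * snd (z c)) by (unfold m; nra).
    cbv beta in E.
    rewrite H0, Rminus_diag, Rmult_0_r, exp_0 in E; simpl in E.
    assert (0 <= (fst (z c) * (1 - exp (- alpha * snd (z c))) + m * snd (z c))
      * exp (m * (c - t0)) * (tau - t0)).
    { apply Rmult_le_pos; [apply Rmult_le_pos |]; lra. }
    apply Rmult_lt_reg_r with (exp (m * (tau - t0))); [exact Het |]. lra.
Qed.

Lemma layer_energy (alpha beta chi B t0 tau : R) (I : R -> Prop) (z : R -> R * R) :
  0 < alpha -> 0 < B -> 0 < chi < beta -> (forall t, t0 <= t -> I t) ->
  ode_solution alpha beta I z -> z t0 = (- B, chi) -> t0 <= tau ->
  (forall t, t0 <= t <= tau -> snd (z t) <= chi) ->
  fst (z tau) ^ 2 / 2 + potential alpha beta chi (snd (z tau)) = B ^ 2 / 2.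
Proof.
  intros Ha HB Hchi HI Hz H0 Htau Hl.
  rewrite (energy_conserved alpha beta chi t0 tau I z); auto; [| lra |].
  - rewrite H0; simpl. rewrite potential_at_chi. field.
  - intros t Ht. apply (layer_pos alpha beta chi B t0 t I z); auto; [lra |].
    intros; apply Hl; lra.
Qed.

Lemma layer_time_bound (alpha beta chi B t0 tau : R) (I : R -> Prop)
    (z : R -> R * R) :
  0 < alpha -> 0 < B -> 0 < chi < beta -> (forall t, t0 <= t -> I t) ->
  ode_solution alpha beta I z -> z t0 = (- B, chi) -> t0 <= tau ->
  (forall t, t0 <= t <= tau -> snd (z t) <= chi) ->
  tau <= t0 + 2 * B / (beta - chi).
Proof.
  intros Ha HB Hchi HI Hz H0 Htau Hl.
  pose proof (layer_energy alpha beta chi B t0 tau I z Ha HB Hchi HI Hz H0 Htau Hl).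
  pose proof (layer_pos alpha beta chi B t0 tau I z Ha HB Hchi HI Hz H0 Htau Hl).
  pose proof (layer_drift alpha beta chi t0 tau I z HI Hz Htau Hl) as Hd.
  assert (Hs : snd (z tau) <= chi) by (apply Hl; lra).
  assert (0 <= potential alpha beta chi (snd (z tau)))
    by (apply potential_nonneg; lra).
  rewrite H0 in Hd; simpl in Hd.
  assert (fst (z tau) <= B) by nra.
  apply Rmult_le_reg_l with (beta - chi); [lra |].
  replace ((beta - chi) * (t0 + 2 * B / (beta - chi)))
    with ((beta - chi) * t0 + 2 * B) by (field; lra).
  lra.
Qed.

(** Just after entry [z1 < 0], hence [z2' <= 0]. *)
Lemma layer_entry (alpha beta chi B t0 : R) (I : R -> Prop) (z : R -> R * R) :
  0 < alpha -> 0 < B -> (forall t, t0 <= t -> I t) ->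
  ode_solution alpha beta I z -> z t0 = (- B, chi) ->
  exists d, 0 < d /\ forall t, t0 <= t <= t0 + d -> snd (z t) <= chi.
Proof.
  intros Ha HB HI Hz H0.
  destruct (Hz t0) as (_ & D1 & _); [apply HI; lra |].
  assert (Hc : continuous (fun t => fst (z t)) t0)
    by (apply (ex_derive_continuous (V := R_NormedModule)); eexists; exact D1).
  destruct (Hc (fun v => v < 0)) as [d Hd].
  { apply (open_lt 0). rewrite H0; simpl; lra. }
  exists (d / 2); split; [pose proof (cond_pos d); lra |].
  intros t Ht.
  destruct (mean_value (fun t => snd (z t))
    (fun t => fst (z t) * (1 - exp (- alpha * snd (z t)))) t0 t) as [c [Hcc E]];
    [lra | |].
  - intros s Hs. apply Hz, HI; lra.
  - cbv beta in E. rewrite H0 in E; simpl in E.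
    assert (fst (z c) < 0).
    { apply Hd. change (Rabs (c - t0) < d).
      pose proof (cond_pos d). apply Rabs_def1; lra. }
    destruct (Hz c) as (P & _); [apply HI; lra |].
    pose proof (one_minus_exp_bounds alpha _ Ha P) as Hb.
    assert (0 <= (- fst (z c)) * (1 - exp (- alpha * snd (z c))) * (t - t0)).
    { apply Rmult_le_pos; [apply Rmult_le_pos |]; lra. }
    lra.
Qed.

Lemma layer_exit (alpha beta chi B t0 : R) (I : R -> Prop) (z : R -> R * R) :
  0 < alpha -> 0 < B -> 0 < chi < beta -> (forall t, t0 <= t -> I t) ->
  ode_solution alpha beta I z -> z t0 = (- B, chi) ->
  exists T, first_exit_time (nbhd_M chi) z t0 T /\ fst (z T) = B.
Proof.
  intros Ha HB Hchi HI Hz H0.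
  (* [A] is the set of times up to which the solution stays in the layer; it
     is bounded by [layer_time_bound], and the exit time is its supremum. *)
  set (A := fun tau => t0 <= tau /\ forall t, t0 <= t <= tau -> snd (z t) <= chi).
  assert (Hcont : forall t, t0 <= t -> continuous (fun t => snd (z t)) t).
  { intros t Ht. apply (ex_derive_continuous (V := R_NormedModule)).
    eexists. apply Hz, HI; lra. }
  destruct (layer_entry alpha beta chi B t0 I z Ha HB HI Hz H0) as [d [Hd Hent]].
  assert (HAd : A (t0 + d)) by (split; [lra | exact Hent]).
  destruct (completeness A) as [T [HT1 HT2]].
  - exists (t0 + 2 * B / (beta - chi)). intros tau [Ht Hl].
    now apply (layer_time_bound alpha beta chi B t0 tau I z).
  - now exists (t0 + d).
  - assert (HT : t0 < T) by (pose proof (HT1 _ HAd); lra).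
    assert (Hbefore : forall t, t0 <= t < T -> snd (z t) <= chi).
    { intros t Ht. apply NNPP; intros Hn.
      enough (T <= t) by lra.
      apply HT2. intros tau [Htau Hl].
      apply Rnot_lt_le; intros Hlt. apply Hn, Hl; lra. }
    assert (HTle : snd (z T) <= chi).
    { apply Rnot_lt_le; intros Hgt.
      destruct (Hcont T ltac:(lra) (fun v => chi < v)) as [e He].
      { now apply (open_gt chi). }
      pose proof (cond_pos e).
      assert (Hm : t0 <= Rmax t0 (T - e / 2) < T)
        by (split; [apply Rmax_l | apply Rmax_lub_lt; lra]).
      pose proof (Rmax_r t0 (T - e / 2)).
      specialize (Hbefore _ Hm).
      enough (chi < snd (z (Rmax t0 (T - e / 2)))) by lra.
      apply He. change (Rabs (Rmax t0 (T - e / 2) - T) < e).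
      apply Rabs_def1; lra. }
    assert (Hlayer : forall t, t0 <= t <= T -> snd (z t) <= chi).
    { intros t [Ht1 [Ht2 | ->]]; [apply Hbefore; lra | exact HTle]. }
    assert (Hafter : forall delta, 0 < delta ->
              exists t, T < t < T + delta /\ chi < snd (z t)).
    { intros delta Hdelta. apply NNPP; intros Hn.
      enough (T + delta / 2 <= T) by lra.
      apply HT1; split; [lra |]. intros t Ht.
      destruct (Rle_lt_dec t T) as [Hle | Hlt]; [apply Hlayer; lra |].
      apply Rnot_lt_le; intros Hgt. apply Hn. exists t; lra. }
    assert (HTeq : snd (z T) = chi).
    { apply Rle_antisym; [exact HTle |].
      apply Rnot_lt_le; intros Hlt.
      destruct (Hcont T ltac:(lra) (fun v => v < chi)) as [e He].
      { now apply (open_lt chi). }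
      destruct (Hafter e (cond_pos e)) as (t & Ht & Hgt).
      enough (snd (z t) < chi) by lra.
      apply He. change (Rabs (t - T) < e). apply Rabs_def1; lra. }
    exists T; split; [split; [exact HT | split] |].
    + intros t Ht; split; [apply Hz, HI; lra | now apply Hlayer].
    + intros delta Hdelta. destruct (Hafter delta Hdelta) as (t & Ht & Hgt).
      exists t; split; [exact Ht |]. unfold nbhd_M; lra.
    + assert (HE := layer_energy alpha beta chi B t0 T I z Ha HB Hchi HI Hz H0
                      ltac:(lra) Hlayer).
      pose proof (layer_drift alpha beta chi t0 T I z HI Hz ltac:(lra) Hlayer) as Hdr.
      rewrite HTeq, potential_at_chi in HE.
      rewrite H0 in Hdr; simpl in Hdr.
      assert (0 < (beta - chi) * (T - t0)) by (apply Rmult_lt_0_compat; lra).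
      assert (Hprod : (fst (z T) - B) * (fst (z T) + B) = 0) by lra.
      apply Rmult_integral in Hprod; lra.
Qed.

Theorem proposition4p2 (alpha beta : R) (halpha : 0 < alpha) (hbeta : 0 < beta) :
  exists (S : scaling) (f g : R -> R -> R -> R),
    smooth f /\ smooth g /\
    converts alpha beta S f g /\
    (forall (eps : R) (p : R * R), 0 < eps ->
       (manifold_M (unscale S eps p) <-> fst p = 0)) /\
    (forall p : R * R, fst p = 0 -> critical_manifold f p) /\
    (forall b s0 : R, 0 < b ->
       (* balancing yields the exit point (0, b) *)
       (exists (I : R -> Prop) (gamma : R -> R * R),
          slow_trajectory_entering f g I gamma s0 b) /\
       (forall (I : R -> Prop) (gamma : R -> R * R),
          slow_trajectory_entering f g I gamma s0 b ->
          exists T : R, balanced_exit_time f gamma s0 T /\ gamma T = (0, b)) /\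
       (* which, in the original coordinates, is where particles entering at
          the point corresponding to (0, - b) really exit *)
       (forall (eps chi t0 : R) (I : R -> Prop) (z : R -> R * R),
          0 < eps -> 0 < chi < beta ->
          is_open_interval I -> (forall t : R, t0 <= t -> I t) ->
          ode_solution alpha beta I z ->
          z t0 = (fst (unscale S eps (0, - b)), chi) ->
          exists T : R,
            first_exit_time (nbhd_M chi) z t0 T /\
            fst (z T) = fst (unscale S eps (0, b)))).
Proof.
  exists sqrt_scaling, (fast_field alpha), (slow_field beta).
  split; [apply smooth_fast_field |].
  split; [apply smooth_slow_field |].
  split; [apply sqrt_scaling_converts |].
  split.
  { intros eps p _. unfold manifold_M, unscale; simpl. lra. }
  split.
  { intros p Hp. unfold critical_manifold, fast_field.
    rewrite Hp, Rmult_0_r, exp_0; ring. }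
  intros b s0 Hb; split; [| split].
  - do 2 eexists. apply (slow_trajectory_exists alpha beta b s0).
  - intros I gamma. now apply balanced_exit_slow_flow.
  - intros eps chi t0 I z Heps Hchi _ HI Hz H0.
    unfold unscale in *; simpl in *.
    apply (layer_exit alpha beta chi _ t0 I z); auto.
    + apply Rmult_lt_0_compat; [now apply (sqrt_scaling_pos eps) | exact Hb].
    + rewrite H0. f_equal. ring.
Qed.
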